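(* There exists a universal constant $B>0$ such that the following holds; moreover one may take $B=8e^2$. For every integer $n\ge 1$, every matrix $A\in\mathbb{C}^{n\times n}$ with zero row and column sums, i.e. $A\mathbf{1}=A^\top\mathbf{1}=0$, and with $\|A\|_{\mathrm{F}}=\left(\sum_{i,j=1}^n|A_{ij}|^2\right)^{1/2}=n$, and every integer $1\le k\le n$, $$|e_k(A)|\le B^k\binom{n}{k}.$$
   Context: Here $\mathbf{1}\in\mathbb{C}^n$ is the all-ones vector and $A^\top$ is the (non-conjugated) transpose. For $A\in\mathbb{C}^{n\times n}$ and $1\le k\le n$, define $$e_k(A)=\frac{1}{k!}\sum_{\substack{S,T\subseteq\{1,\dots,n\}\\ |S|=|T|=k}}\mathrm{Perm}(A_{S,T}),$$ where $A_{S,T}$ is the $k\times k$ submatrix of $A$ with row indices in $S$ and column indices in $T$, and $\mathrm{Perm}(D)=\sum_{\pi\in S_k}\prod_{i=1}^k D_{i,\pi(i)}$ is the permanent of a $k\times k$ matrix $D$ ($S_k$ being the symmetric group). ''Universal constant'' means independent of $n$, $k$ and $A$; $e$ in $8e^2$ is Euler's number. *)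

(* Defs.v *)
From mathcomp Require Import all_boot all_order all_algebra all_fingroup.
From mathcomp Require Import complex.
From mathcomp Require Import reals sequences exp.

Set Implicit Arguments.
Unset Strict Implicit.
Unset Printing Implicit Defensive.

Import Order.TTheory GRing.Theory Num.Theory.
Local Open Scope ring_scope.
Local Open Scope complex_scope.

Definition permanent (C : comNzRingType) (k : nat) (D : 'M[C]_k) : C :=
  \sum_(s : 'S_k) \prod_(i < k) D i (s i).

(* The rows in S and the columns in T, both listed in increasing order.
   The type of [mxsub] only gives the dimensions #|S| and #|T|; [conform_mx]
   casts them to k. Its default [const_mx 0] is never reached when
   #|S| = #|T| = k. *)
Definition submatrix (C : comNzRingType) (n k : nat) (A : 'M[C]_n)
    (S T : {set 'I_n}) : 'M[C]_k :=
  conform_mx (const_mx 0)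
    (mxsub (fun i : 'I_#|S| => enum_val i) (fun j : 'I_#|T| => enum_val j) A).

Definition ek (C : fieldType) (n k : nat) (A : 'M[C]_n) : C :=
  (k`!%:R)^-1 *
  \sum_(S : {set 'I_n} | #|S| == k) \sum_(T : {set 'I_n} | #|T| == k)
    permanent (submatrix k A S T).

Definition frobenius (C : numClosedFieldType) (n : nat) (A : 'M[C]_n) : C :=
  sqrtC (\sum_(i < n) \sum_(j < n) `|A i j| ^+ 2).

(* Norms on R[i] take values in R[i], ordered by
   x <= y iff Im x = Im y and Re x <= Re y; both sides of the inequality are
   real, so this is the usual order there. *)
Definition ek_bound (R : realType) (B : R) : Prop :=
  forall (n : nat) (A : 'M[R[i]]_n) (k : nat),
    (1 <= n)%N ->
    A *m const_mx 1 = 0 :> 'cV[R[i]]_n ->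
    A^T *m const_mx 1 = 0 :> 'cV[R[i]]_n ->
    frobenius A = n%:R ->
    (1 <= k <= n)%N ->
    `|ek k A| <= B%:C ^+ k * 'C(n, k)%:R.

(* Main.v *)
Require Import Defs.
From mathcomp Require Import all_boot all_order all_algebra all_fingroup.
From mathcomp Require Import complex ring lra zify.
From mathcomp Require Import reals sequences exp.
Import Order.TTheory GRing.Theory Num.Theory.
Set Implicit Arguments.
Unset Strict Implicit.
Unset Printing Implicit Defensive.
Local Open Scope ring_scope.

(** Write [k] for the degree and let [f], [g] range over maps from [k] points
    to the [n] row, respectively column, indices.  Listing the rows and columns
    of each submatrix in every order turns [k!^2 e_k(A)] into the sum of
    [prod_l A (f l) (g l)] over all pairs of injective maps
    ([ek_sum_injective]).  Bounding that sum termwise is hopeless: the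
    cancellation coming from the zero row and column sums has to be used first.

    For vectors [u_l] of sum zero, [prod_i (1 + z_i)] and
    [prod_i (1 + z_i) exp (- z_i)] have the same polarised expansion, because
    the exponential only contributes the sums of the [u_l].  The second product
    has no term of degree one in any variable, and its coefficients are, up to
    signs and factorials, products of factors [a - 1].  So the sum over
    injective [f] equals, up to sign, a sum over all [f] in which [f] carries
    the weight [prod_i (1 - #|f^-1(i)|)] ([sum_injective]).  This weight
    vanishes as soon as some fibre of [f] is a singleton, and its square is at
    most [2^k].  Applying this to the columns and then to the rows leaves a sum
    over maps without singleton fibres, which can be bounded with absolute
    values.

    The bound on that sum is [sum_no_singleton]: for nonnegative vectors,
    [sum_f prod_l v_l (f l) <= (2 sqrt k)^k prod_l ||v_l||_2] over all [f]
    without singleton fibre.  Remove one point [l].  Either its fibre is a pair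
    [{l, l'}], and Cauchy-Schwarz bounds what the pair contributes by
    [||v_l|| ||v_l'||], with fewer than [k] choices of [l']; or the remaining
    points still have no singleton fibre and [f l] is one of at most [k] values
    already taken, which contributes at most [sqrt k ||v_l||].  With
    [c = 2 sqrt k] the induction closes because [k c^-2 + sqrt k c^-1] is
    [1/4 + 1/2].

    Used on the columns for fixed [f], this bound leaves the Euclidean norms of
    the rows of [A]; used again on the rows, it leaves the Frobenius norm.
    Hence [k!^2 |e_k(A)| <= 2^k (2 sqrt k)^(2 k) n^k = (8 k n)^k], and the
    theorem follows from [k^k <= k! e^k] and [n^k <= k^k C(n, k)]. *)

(** * Summing out one coordinate *)

Definition update (L I : finType) (f : {ffun L -> I}) (l : L) (i : I) :
  {ffun L -> I} := [ffun x => if x == l then i else f x].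

(** Pinning the values outside [X] makes these functions stand for the
    functions defined on [X] alone, so that subsets of [L] can be used in an
    induction without changing the type. *)
Definition trivial_off (L I : finType) (i0 : I) (X : {set L})
  (f : {ffun L -> I}) : bool := [forall l, (l \notin X) ==> (f l == i0)].

Lemma update_same (L I : finType) (f : {ffun L -> I}) l i :
  update f l i l = i.
Proof. by rewrite ffunE eqxx. Qed.

Lemma update_other (L I : finType) (f : {ffun L -> I}) l i x :
  x != l -> update f l i x = f x.
Proof. by rewrite ffunE => /negPf ->. Qed.

Lemma sum_update (V : nmodType) (L I : finType) (i0 : I) (X : {set L}) (l : L)
    (G : {ffun L -> I} -> V) : l \in X ->
  \sum_(f | trivial_off i0 X f) G f =
  \sum_(f | trivial_off i0 (X :\ l) f) \sum_i G (update f l i).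
Proof.
move=> lX; rewrite pair_big_dep /=.
rewrite (reindex_onto (fun p : {ffun L -> I} * I => update p.1 l p.2)
                      (fun f => (update f l i0, f l))) /=; last first.
  by move=> f _; apply/ffunP => x; rewrite !ffunE; case: eqP => // ->.
apply: eq_bigl => -[f i] /=; rewrite andbT update_same.
apply/andP/forallP => [[/forallP off /eqP[fE]] x | off].
  apply/implyP; rewrite !inE negb_and negbK => /orP[/eqP->|xX].
    by rewrite -fE !ffunE eqxx.
  have xl : x != l by apply: contraNneq xX => ->.
  by move/implyP: (off x) => /(_ xX); rewrite update_other.
split.
  apply/forallP => x; apply/implyP => xX.
  have xl : x != l by apply: contraNneq xX => ->.
  by rewrite update_other //; apply: (implyP (off x)); rewrite !inE xl.
rewrite xpair_eqE eqxx andbT; apply/eqP/ffunP => x; rewrite !ffunE.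
case: eqP => // ->; apply/esym/eqP; apply: (implyP (off l)).
by rewrite !inE eqxx.
Qed.

Lemma trivial_offT (L I : finType) (i0 : I) (f : {ffun L -> I}) :
  trivial_off i0 [set: L] f.
Proof. by apply/forallP => l; rewrite inE. Qed.

Lemma prod_setT (R : comPzRingType) (L : finType) (F : L -> R) :
  \prod_(x in [set: L]) F x = \prod_x F x.
Proof. by apply: eq_bigl => x; rewrite inE. Qed.

Lemma prod_update (R : comPzRingType) (L I : finType) (X : {set L}) (l : L)
    (u : L -> I -> R) (f : {ffun L -> I}) (i : I) : l \in X ->
  \prod_(x in X) u x (update f l i x) =
  u l i * \prod_(x in X :\ l) u x (f x).
Proof.
move=> lX; rewrite (big_setD1 _ lX) /= update_same; congr (_ * _).
by apply: eq_bigr => x; rewrite !inE => /andP[xl _]; rewrite update_other.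
Qed.

(** Zero-sum vectors annihilate everything that does not depend on one of the
    coordinates: this is the only source of cancellation in the proof. *)
Lemma sum_mean_zero_coordinate (R : comPzRingType) (L I : finType) (l : L)
    (u : L -> I -> R) (c : {ffun L -> I} -> R) :
  \sum_i u l i = 0 -> (forall f i, c (update f l i) = c f) ->
  \sum_(f : {ffun L -> I}) c f * \prod_x u x (f x) = 0.
Proof.
move=> u0 cl; have [i0 _|noI] := pickP (xpredT : pred I); last first.
  by apply: big1 => f _; have := noI (f l).
rewrite (eq_bigl (trivial_off i0 [set: L])); last first.
  by move=> f; rewrite trivial_offT.
rewrite (sum_update _ _ (in_setT l)) big1 // => f _.
under eq_bigr => i _.
  rewrite cl -prod_setT (prod_update _ _ _ (in_setT l)) mulrCA; over.
by rewrite -mulr_suml u0 mul0r.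
Qed.

(** * Trading injectivity for the absence of singleton fibres *)

(** The factor of a fibre of size [a] is, up to the sign [(-1)^a], the
    coefficient of [z^a / a!] in [(1 + z) exp (- z)]. *)
Definition fibre_weight (R : comPzRingType) (L I : finType)
  (f : {ffun L -> I}) : R := \prod_i (1 - #|[set l | f l == i]|%:R).

(** Expanding the weight selects, for each value [i], nothing or one point of
    the fibre over [i].  If the selection misses a point, the sum over the value
    of [f] there is zero.  If it exhausts all points, it picks one point in each
    nonempty fibre and so forces [f] to be injective. *)
Lemma sum_injective (R : comPzRingType) (L I : finType) (u : L -> I -> R) :
  (forall l, \sum_i u l i = 0) ->
  \sum_(f : {ffun L -> I} | injectiveb f) \prod_l u l (f l) =
  (-1) ^+ #|L| *
  \sum_(f : {ffun L -> I}) fibre_weight R f * \prod_l u l (f l).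
Proof.
move=> u0.
pose F (f : {ffun L -> I}) i (o : option L) : R :=
  if o is Some l then - (f l == i)%:R else 1.
pose onto (h : {ffun I -> option L}) := [forall l, exists i, h i == Some l].
have weightE f : fibre_weight R f =
    \sum_(h : {ffun I -> option L}) \prod_i F f i (h i).
  rewrite -(bigA_distr_bigA (F f)); apply: eq_bigr => i _.
  rewrite (bigD1 None) //=; congr (_ + _).
  rewrite (reindex_omap Some id) /=; last by case.
  rewrite (eq_bigl xpredT) => [|l]; last by rewrite /= eqxx.
  by rewrite sumrN -natr_sum -big_mkcond sum1dep_card.
(* A selection that misses [l] does not constrain the value [f l]. *)
have vanish h : ~~ onto h ->
    \sum_(f : {ffun L -> I}) (\prod_i F f i (h i)) * \prod_l u l (f l) = 0.
  rewrite negb_forall => /existsP[l /existsPn hl].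
  apply: (sum_mean_zero_coordinate (l := l)) => // f i0; apply: eq_bigr => i _.
  case: (h i) (hl i) => //= l' ll'; rewrite update_other //.
have ontoE f : \sum_(h | onto h) \prod_i F f i (h i) =
    (injectiveb f)%:R * (-1) ^+ #|L|.
  have compatible h i l : \prod_i F f i (h i) != 0 -> h i = Some l -> f l = i.
    move=> + hi; apply: contra_neq_eq => fl.
    by rewrite (bigD1 i) //= hi /F (negPf fl) oppr0 mul0r.
  have [/injectiveP finj|ninj] := boolP (injectiveb f); last first.
    rewrite mul0r big1 // => h /forallP onto_h; apply: contraNeq ninj => nz.
    apply/injectiveP => l l' ff'.
    have /existsP[i /eqP hi] := onto_h l; have /existsP[i' /eqP hi'] := onto_h l'.
    have := compatible _ _ _ nz hi; have := compatible _ _ _ nz hi'.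
    by rewrite -ff' => -> ii'; move: hi hi'; rewrite ii' => -> [].
  (* The only selection that contributes when [f] is injective. *)
  pose hf : {ffun I -> option L} := [ffun i => [pick l | f l == i]].
  have hfE l : hf (f l) = Some l.
    by rewrite ffunE; case: pickP => [l' /eqP/finj->|/(_ l)]; rewrite ?eqxx.
  rewrite (bigD1 hf) /=; last first.
    by apply/forallP => l; apply/existsP; exists (f l); rewrite hfE.
  rewrite [X in _ + X]big1 ?addr0 => [|h /andP[/forallP onto_h]]; last first.
    apply: contraNeq => nz; apply/eqP/ffunP => i.
    case hi: (h i) => [l|]; first by rewrite -(compatible _ _ _ nz hi) hfE.
    rewrite ffunE; case: pickP => // l /eqP fl.
    have /existsP[i' /eqP hi'] := onto_h l.
    by move: hi; rewrite -fl (compatible _ _ _ nz hi') hi'.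
  rewrite mul1r (bigID (mem (codom f))) /= [X in _ * X]big1 ?mulr1 => [|i].
    rewrite -(card_codom finj) -prodr_const; apply: eq_bigr => i /codomP[l ->].
    by rewrite hfE /F eqxx.
  move=> fi; rewrite ffunE; case: pickP => //= l /eqP fl.
  by case/negP: fi; rewrite -fl codom_f.
under [in RHS]eq_bigr => f _ do rewrite weightE mulr_suml.
rewrite exchange_big (bigID onto) /= [X in _ + X]big1 // addr0 exchange_big /=.
under [in RHS]eq_bigr => f _ do rewrite -mulr_suml ontoE.
rewrite mulr_sumr big_mkcond; apply: eq_bigr => f _.
rewrite mulrA mulrCA -exprD addnn -muln2 mulnC exprM sqrrN !expr1n mulr1.
by case: ifP => _; rewrite ?mul1r ?mul0r.
Qed.

Lemma sqrn_le_expn2 b : (b ^ 2 <= 2 ^ b.+1)%N.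
Proof.
case: b => [|[|[|b]]] //; elim: b => // b IH.
rewrite expnS; apply: leq_trans (leq_mul (leqnn 2) IH).
nia.
Qed.

(** The sizes of the fibres add up to [#|L|], so it is enough that
    [(1 - a)^2 <= 2^a] for each of them. *)
Lemma fibre_weight_sqr (C : numDomainType) (L I : finType)
    (f : {ffun L -> I}) :
  `|fibre_weight C f| ^+ 2 <= 2 ^+ #|L|.
Proof.
have -> : (2 : C) ^+ #|L| = \prod_i 2 ^+ #|[set l | f l == i]|.
  rewrite prodrXr -sum1_card (partition_big f xpredT) //=.
  by congr (_ ^+ _); apply: eq_bigr => i _; rewrite sum1dep_card.
rewrite /fibre_weight normr_prod -prodrXl; apply: ler_prod => i _.
rewrite exprn_ge0 //=; case: #|_| => [|b]; first by rewrite subr0 normr1 expr1n.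
rewrite -natr1 opprD addrC addrNK normrN normr_nat -!natrX ler_nat.
exact: sqrn_le_expn2.
Qed.

Definition no_singleton (L I : finType) (X : {set L}) (f : {ffun L -> I}) :=
  [forall x in X, exists y in X, (y != x) && (f y == f x)].

Lemma fibre_weight_eq0 (R : comPzRingType) (L I : finType)
    (f : {ffun L -> I}) :
  ~~ no_singleton [set: L] f -> fibre_weight R f = 0.
Proof.
rewrite negb_forall_in => /existsP[x /andP[_ /existsPn hx]].
rewrite /fibre_weight (bigD1 (f x)) //=.
suff -> : [set l | f l == f x] = [set x] by rewrite cards1 subrr mul0r.
apply/setP => y; rewrite !inE; apply/idP/eqP => [fxy|-> //].
by have := hx y; rewrite inE fxy andbT /= negbK => /eqP.
Qed.

(** * Euclidean norms of nonnegative vectors *)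

Definition l2norm (C : numClosedFieldType) (I : finType) (v : I -> C) : C :=
  sqrtC (\sum_i v i ^+ 2).

Lemma l2norm_ge0 (C : numClosedFieldType) (I : finType) (v : I -> C) :
  (forall i, 0 <= v i) -> 0 <= l2norm v.
Proof. by move=> v0; rewrite sqrtC_ge0 sumr_ge0 // => i _; rewrite exprn_ge0. Qed.

(** The Cauchy-Schwarz inequality, from Lagrange's identity. *)
Lemma sum_prod_le_l2norm (C : numClosedFieldType) (I : finType) (a b : I -> C) :
  (forall i, 0 <= a i) -> (forall i, 0 <= b i) ->
  \sum_i a i * b i <= l2norm a * l2norm b.
Proof.
move=> a0 b0.
rewrite -(@ler_pXn2r _ 2) ?nnegrE ?mulr_ge0 ?l2norm_ge0 //; last first.
  by apply: sumr_ge0 => i _; rewrite mulr_ge0.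
rewrite exprMn !sqrtCK -subr_ge0 -(@pmulr_rge0 _ 2) //.
suff -> : 2 * ((\sum_i a i ^+ 2) * (\sum_i b i ^+ 2)
               - (\sum_i a i * b i) ^+ 2) =
          \sum_i \sum_j (a i * b j - a j * b i) ^+ 2.
  apply: sumr_ge0 => i _; apply: sumr_ge0 => j _.
  by rewrite real_exprn_even_ge0 // rpredB // ger0_real // mulr_ge0.
have sumM (u v : I -> C) :
    (\sum_i u i) * (\sum_j v j) = \sum_i \sum_j u i * v j.
  by rewrite mulr_suml; apply: eq_bigr => i _; rewrite mulr_sumr.
rewrite [RHS](eq_bigr (fun i => \sum_j (a i ^+ 2 * b j ^+ 2)
  + \sum_j (b i ^+ 2 * a j ^+ 2) - 2 * \sum_j (a i * b i * (a j * b j)))).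
  rewrite sumrB big_split /= -mulr_sumr -!sumM; ring.
move=> i _; rewrite mulr_sumr -big_split -sumrB /=.
by apply: eq_bigr => j _; ring.
Qed.

Lemma sum_le_sqrt_card (C : numClosedFieldType) (I : finType) (D : {set I})
    (v : I -> C) : (forall i, 0 <= v i) ->
  \sum_(i in D) v i <= sqrtC #|D|%:R * l2norm v.
Proof.
move=> v0; rewrite big_mkcond /=.
have -> : #|D|%:R = \sum_i (i \in D)%:R ^+ 2 :> C.
  rewrite -sum1_card natr_sum big_mkcond; apply: eq_bigr => i _.
  by case: ifP => _; rewrite ?expr1n ?expr0n.
apply: le_trans (sum_prod_le_l2norm (a := fun i => (i \in D)%:R) _ v0) => //.
by apply: ler_sum => i _; case: ifP => _; rewrite ?mul1r ?mul0r.
Qed.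

(** * Maps without singleton fibres *)

(** If removing [l] creates a singleton fibre [{l'}], then [l'] was only
    accompanied by [l]; so [{l, l'}] was a whole fibre, and removing both leaves
    the other fibres intact. *)
Lemma no_singleton_split (L I : finType) (X : {set L}) (l : L)
    (f : {ffun L -> I}) : l \in X -> no_singleton X f ->
  (exists2 l', l' \in X :\ l &
     (f l' == f l) && no_singleton (X :\ l :\ l') f) \/
  no_singleton (X :\ l) f && (f l \in f @: (X :\ l)).
Proof.
move=> lX /forall_inP ns.
have [nsl|] := boolP (no_singleton (X :\ l) f).
  right; have /exists_inP[y yX /andP[yl /eqP fyl]] := ns _ lX.
  by rewrite -fyl imset_f // !inE yl.
rewrite negb_forall_in => /exists_inP[x xXl /exists_inPn hx]; left; exists x => //.
move: (xXl); rewrite !inE => /andP[xl xX].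
have xalone y : y \in X -> y != x -> f y = f x -> y = l.
  move=> yX yx fyx; apply: contraTeq isT => yl.
  by have := hx y; rewrite !inE yl yX yx fyx eqxx => /(_ isT).
have /exists_inP[y yX /andP[yx /eqP fyx]] := ns _ xX.
have fxl : f l = f x by rewrite -(xalone y yX yx fyx).
rewrite fxl eqxx; apply/forall_inP => z; rewrite !inE => /and3P[zx zl zX].
have /exists_inP[t tX /andP[tz /eqP ftz]] := ns _ zX.
apply/exists_inP; exists t; last by rewrite tz ftz eqxx.
rewrite !inE tX andbT; apply/andP; split; apply: contraNneq zl => te.
  by apply/eqP/(xalone z zX zx); rewrite -ftz te.
by apply/eqP/(xalone z zX zx); rewrite -ftz te.
Qed.

Lemma eq_no_singleton (L I : finType) (X : {set L}) (f g : {ffun L -> I}) :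
  {in X, f =1 g} -> no_singleton X f = no_singleton X g.
Proof.
move=> fg; apply: eq_forallb_in => x xX; apply: eq_existsb_in => y yX.
by rewrite !fg.
Qed.

(** The parameter [s] stays fixed when points are removed, which keeps square
    roots of varying cardinals out of the induction: each removal costs the
    constant factor [2 * s] per point. *)
Lemma sum_no_singleton (C : numClosedFieldType) (L I : finType) (i0 : I)
    (v : L -> I -> C) (s : C) (X : {set L}) :
  (forall l i, 0 <= v l i) -> 0 <= s -> #|X|%:R <= s ^+ 2 ->
  \sum_(f : {ffun L -> I} | trivial_off i0 X f && no_singleton X f)
     \prod_(l in X) v l (f l)
  <= (2 * s) ^+ #|X| * \prod_(l in X) l2norm (v l).
Proof.
move=> v0 s0; have [m] := ubnP #|X|; elim: m X => // m IH X /ltnSE leXm leXs.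
have nrm0 l := l2norm_ge0 (v0 l).
have prod0 (Y : {set L}) (f : {ffun L -> I}) : 0 <= \prod_(l in Y) v l (f l).
  by apply: prodr_ge0 => l _.
have sumM (Y : {set L}) : \sum_(f | trivial_off i0 Y f)
      (no_singleton Y f)%:R * \prod_(l in Y) v l (f l) =
    \sum_(f | trivial_off i0 Y f && no_singleton Y f) \prod_(l in Y) v l (f l).
  rewrite big_mkcondr; apply: eq_bigr => f _.
  by case: ifP => _; rewrite ?mul1r ?mul0r.
have [->|[l lX]] := set_0Vmem X.
  rewrite cards0 expr0 mul1r !big_set0 (big_pred1 [ffun=> i0]) ?big_set0 // => f.
  have -> : no_singleton set0 f by apply/forall_inP => x; rewrite inE.
  rewrite andbT; apply/forallP/eqP => [off|-> x].
    by apply/ffunP => x; have := off x; rewrite inE ffunE => /eqP.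
  by rewrite ffunE eqxx implybT.
set P := \prod_(x in X) _.
pose pair_term (l' : L) (f : {ffun L -> I}) : C :=
  ((f l' == f l) && no_singleton (X :\ l :\ l') f)%:R
    * \prod_(x in X) v x (f x).
pose rest_term (f : {ffun L -> I}) : C :=
  (no_singleton (X :\ l) f && (f l \in f @: (X :\ l)))%:R
    * \prod_(x in X) v x (f x).
have P0 : 0 <= P by rewrite prodr_ge0.
have cardX : #|X| = #|X :\ l|.+1 by rewrite (cardsD1 l) lX.
(* One term for each possible shape of the fibre of [l]. *)
have split_bound : \sum_(f | trivial_off i0 X f && no_singleton X f)
    \prod_(x in X) v x (f x) <=
  \sum_(l' in X :\ l) \sum_(f | trivial_off i0 X f) pair_term l' f
  + \sum_(f | trivial_off i0 X f) rest_term f.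
  rewrite exchange_big -big_split big_mkcondr /=; apply: ler_sum => f _.
  have pair0 : 0 <= \sum_(l' in X :\ l) pair_term l' f.
    by apply: sumr_ge0 => l' _; rewrite mulr_ge0.
  have rest0 : 0 <= rest_term f by rewrite mulr_ge0.
  case: ifP => [nsf|_]; last by rewrite addr_ge0.
  have [[l' l'X hf]|hf] := no_singleton_split lX nsf.
    rewrite (bigD1 l' l'X) /= {1}/pair_term hf mul1r -addrA lerDl addr_ge0 //.
    by apply: sumr_ge0 => x _; rewrite mulr_ge0.
  by rewrite [X in _ + X]/rest_term hf mul1r lerDr.
have pair_bound l' : l' \in X :\ l ->
    \sum_(f | trivial_off i0 X f) pair_term l' f <= (2 * s) ^+ #|X|.-2 * P.
  move=> l'X; rewrite (sum_update _ _ lX) (sum_update _ _ l'X).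
  have l'l : l' != l by move: l'X; rewrite !inE => /andP[].
  have cardXl : #|X :\ l| = #|X :\ l :\ l'|.+1 by rewrite (cardsD1 l') l'X.
  apply: (@le_trans _ _ (\sum_(f | trivial_off i0 (X :\ l :\ l') f)
     (no_singleton (X :\ l :\ l') f)%:R * \prod_(x in X :\ l :\ l') v x (f x)
       * (l2norm (v l) * l2norm (v l')))).
    apply: ler_sum => f _.
    apply: le_trans (ler_wpM2l _ (sum_prod_le_l2norm (v0 l) (v0 l'))); last first.
      by rewrite mulr_ge0.
    rewrite mulr_sumr exchange_big /=; apply: ler_sum => i _.
    rewrite (bigD1 i) //= big1 ?addr0 => [|j ji]; last first.
      by rewrite /pair_term update_same update_other // update_same
          (negPf ji) mul0r.
    rewrite /pair_term update_same update_other // update_same eqxx /=.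
    rewrite !prod_update // (@eq_no_singleton _ _ _ _ f) => [|x]; last first.
      by rewrite !inE => /and3P[xl' xl _]; rewrite !update_other.
    by rewrite -subr_ge0 [X in 0 <= X](_ : _ = 0) //; ring.
  rewrite -mulr_suml sumM /P (big_setD1 l) //= (big_setD1 l') //= cardX cardXl /=.
  rewrite [leRHS](_ : _ = (2 * s) ^+ #|X :\ l :\ l'|
    * (\prod_(x in X :\ l :\ l') l2norm (v x)) * (l2norm (v l) * l2norm (v l')));
    last by ring.
  rewrite ler_wpM2r ?mulr_ge0 //; apply: IH.
    by apply: leq_trans leXm; rewrite cardX cardXl; lia.
  by apply: le_trans leXs; rewrite ler_nat cardX cardXl; lia.
have rest_bound :
    \sum_(f | trivial_off i0 X f) rest_term f <= s * (2 * s) ^+ #|X|.-1 * P.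
  rewrite (sum_update _ _ lX).
  apply: (@le_trans _ _ (\sum_(f | trivial_off i0 (X :\ l) f)
     (no_singleton (X :\ l) f)%:R * \prod_(x in X :\ l) v x (f x)
       * (s * l2norm (v l)))).
    apply: ler_sum => f _.
    have image_bound : \sum_(i in f @: (X :\ l)) v l i <= s * l2norm (v l).
      apply: le_trans (sum_le_sqrt_card _ (v0 l)) _.
      rewrite ler_wpM2r // -(@ler_pXn2r _ 2) ?nnegrE ?sqrtC_ge0 ?ler0n //.
      rewrite sqrtCK; apply: le_trans leXs; rewrite ler_nat cardX.
      exact: leq_trans (leq_imset_card _ _) (leqnSn _).
    apply: le_trans (ler_wpM2l _ image_bound); last by rewrite mulr_ge0.
    rewrite mulr_sumr [leRHS]big_mkcond /=; apply: ler_sum => i _.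
    have fE : {in X :\ l, update f l i =1 f}.
      by move=> x; rewrite !inE => /andP[xl _]; rewrite update_other.
    rewrite /rest_term prod_update // (eq_no_singleton fE) update_same.
    rewrite (eq_in_imset fE); case: (no_singleton _ _); case: (i \in _) => /=;
      by rewrite ?mul0r ?mul1r // mulrC.
  rewrite -mulr_suml sumM /P (big_setD1 l) //= cardX /=.
  rewrite [leRHS](_ : _ = (2 * s) ^+ #|X :\ l|
    * (\prod_(x in X :\ l) l2norm (v x)) * (s * l2norm (v l))); last by ring.
  rewrite ler_wpM2r ?mulr_ge0 //; apply: IH; first by rewrite -cardX.
  by apply: le_trans leXs; rewrite ler_nat cardX.
apply: le_trans split_bound _.
(* The pairs cost at most [s^2 (2 s)^(#|X| - 2)], a quarter of the target, and
   the other case costs half of it. *)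
apply: le_trans (lerD (ler_sum _ pair_bound) rest_bound) _.
rewrite sumr_const cardX /= -[_ *+ #|_|]mulr_natr.
have : #|X :\ l|%:R <= s ^+ 2 by apply: le_trans leXs; rewrite ler_nat cardX.
case: #|X :\ l| => [|d] ds /=.
  rewrite mulr0 add0r expr1 ler_wpM2r // -subr_ge0 [X in 0 <= X](_ : _ = s) //; ring.
have Q0 : 0 <= (2 * s) ^+ d * P by rewrite mulr_ge0 // exprn_ge0 // mulr_ge0.
rewrite [X in _ + X](_ : _ = 2 * s ^+ 2 * ((2 * s) ^+ d * P)); last first.
  by rewrite exprS; ring.
rewrite [leRHS](_ : _ = 4 * s ^+ 2 * ((2 * s) ^+ d * P)); last first.
  by rewrite !exprS; ring.
apply: le_trans (_ : s ^+ 2 * ((2 * s) ^+ d * P)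
                     + 2 * s ^+ 2 * ((2 * s) ^+ d * P) <= _).
  by rewrite lerD2r mulrC ler_wpM2r.
rewrite -mulrDl ler_wpM2r //.
by rewrite -subr_ge0 [X in 0 <= X](_ : _ = s ^+ 2) ?exprn_ge0 //; ring.
Qed.

Lemma sum_no_singletonT (C : numClosedFieldType) (k n : nat) (i0 : 'I_n)
    (v : 'I_k -> 'I_n -> C) : (forall l i, 0 <= v l i) ->
  \sum_(f : {ffun 'I_k -> 'I_n} | no_singleton [set: 'I_k] f)
     \prod_l v l (f l)
  <= (2 * sqrtC k%:R) ^+ k * \prod_l l2norm (v l).
Proof.
move=> v0; have := sum_no_singleton i0 (s := sqrtC k%:R) (X := [set: 'I_k]) v0.
rewrite sqrtC_ge0 ler0n sqrtCK cardsT card_ord lexx => /(_ isT isT).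
rewrite prod_setT; congr (_ <= _); apply: eq_big => [f|f _].
  by rewrite trivial_offT.
exact: prod_setT.
Qed.

(** * From permanents to pairs of injective maps *)

Lemma submatrixE (C : comNzRingType) (n k : nat) (A : 'M[C]_n)
    (S T : {set 'I_n}) (i0 : 'I_n) (i j : 'I_k) :
  #|S| = k -> #|T| = k ->
  submatrix k A S T i j = A (nth i0 (enum S) i) (nth i0 (enum T) j).
Proof.
move=> cS cT.
have conformE p q r (M : 'M[C]_(p, q)) (D : 'M[C]_r) (ep : p = r) (eq : q = r)
    (x y : 'I_r) :
    conform_mx D M x y = M (cast_ord (esym ep) x) (cast_ord (esym eq) y).
  by subst p; subst q; rewrite conform_mx_id !cast_ord_id.
rewrite /submatrix (conformE _ _ _ _ _ cS cT) mxE.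
by rewrite !(enum_val_nth i0).
Qed.

(** An injective map is the increasing enumeration of its image composed with
    a permutation. *)
Lemma sum_injective_image (V : nmodType) (n k : nat) (i0 : 'I_n)
    (G : {ffun 'I_k -> 'I_n} -> V) :
  \sum_(f : {ffun 'I_k -> 'I_n} | injectiveb f) G f =
  \sum_(S : {set 'I_n} | #|S| == k) \sum_(s : 'S_k)
     G [ffun l => nth i0 (enum S) (s l)].
Proof.
rewrite (partition_big (fun f : {ffun 'I_k -> 'I_n} => f @: [set: 'I_k])
  (fun S : {set 'I_n} => #|S| == k)) /= => [|f /injectiveP finj]; last first.
  by rewrite card_imset // cardsT card_ord.
apply: eq_bigr => S /eqP cS.
have szS (s : 'S_k) l : (s l < size (enum S))%N by rewrite -cardE cS.
have list_inj : injective (fun s : 'S_k => [ffun l => nth i0 (enum S) (s l)]).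
  move=> s t /ffunP st; apply/permP => l; have := st l; rewrite !ffunE.
  by move/eqP; rewrite nth_uniq ?enum_uniq // => /eqP /val_inj.
rewrite -(big_imset G (in2W list_inj)); apply: eq_bigl => f.
apply/andP/imsetP => [[/injectiveP finj /eqP fS]|[s _ ->]].
  have fl l : f l \in enum S by rewrite mem_enum -fS imset_f.
  have idx l : (index (f l) (enum S) < k)%N.
    by rewrite -[X in (_ < X)%N]cS cardE index_mem.
  have idx_inj : injective (fun l => Ordinal (idx l)).
    move=> l l' /(congr1 val) /= e; apply: finj.
    by rewrite -(nth_index i0 (fl l)) e nth_index.
  exists (perm idx_inj) => //; apply/ffunP => l.
  by rewrite ffunE permE nth_index.
have inj : injective [ffun l => nth i0 (enum S) (s l)].
  move=> l l'; rewrite !ffunE => /eqP; rewrite nth_uniq ?enum_uniq //.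
  by move/eqP/val_inj/perm_inj.
split; first exact/injectiveP.
rewrite eqEcard card_imset // cardsT card_ord cS leqnn andbT.
by apply/subsetP => _ /imsetP[l _ ->]; rewrite ffunE -mem_enum mem_nth.
Qed.

(** Each permanent occurs [k!] times, once for every order of the rows; this is
    where the second factorial comes from. *)
Lemma ek_sum_injective (C : numClosedFieldType) (n k : nat) (i0 : 'I_n)
    (A : 'M[C]_n) :
  k`!%:R ^+ 2 * ek k A =
  \sum_(f : {ffun 'I_k -> 'I_n} | injectiveb f)
    \sum_(g : {ffun 'I_k -> 'I_n} | injectiveb g) \prod_l A (f l) (g l).
Proof.
have k0 : k`!%:R != 0 :> C by rewrite pnatr_eq0 -lt0n fact_gt0.
rewrite /ek expr2 -mulrA mulVKf // mulr_sumr.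
under [RHS]eq_bigr => f _ do rewrite (sum_injective_image i0).
rewrite (sum_injective_image i0); apply: eq_bigr => S /eqP cS.
rewrite [RHS]exchange_big mulr_sumr; apply: eq_bigr => T /eqP cT /=.
rewrite [RHS](eq_bigr (fun=> permanent (submatrix k A S T))).
  by rewrite sumr_const card_Sn mulr_natl.
move=> s _; rewrite /permanent (reindex_inj (mulgI s)) /=.
apply: eq_bigr => t _; rewrite [RHS](reindex_inj (@perm_inj _ s)) /=.
by apply: eq_bigr => l _; rewrite !ffunE permM (submatrixE A i0).
Qed.

(** * The bound by the Frobenius norm *)

Lemma ek_frobenius_bound (C : numClosedFieldType) (n k : nat) (A : 'M[C]_n) :
  (0 < n)%N ->
  A *m const_mx 1 = 0 :> 'cV_n -> A^T *m const_mx 1 = 0 :> 'cV_n ->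
  k`!%:R ^+ 2 * `|ek k A| <= (8 * k%:R * frobenius A) ^+ k.
Proof.
move=> n0 A1 AT1; have i0 : 'I_n := Ordinal n0.
have row0 i : \sum_j A i j = 0.
  transitivity ((A *m const_mx 1 : 'cV_n) i ord0); last by rewrite A1 mxE.
  by rewrite mxE; apply: eq_bigr => j _; rewrite mxE mulr1.
have col0 j : \sum_i A i j = 0.
  transitivity ((A^T *m const_mx 1 : 'cV_n) j ord0); last by rewrite AT1 mxE.
  by rewrite mxE; apply: eq_bigr => i _; rewrite !mxE mulr1.
(* The columns are treated first, then the rows; the two signs cancel. *)
pose w (f : {ffun 'I_k -> 'I_n}) := fibre_weight C f.
have sumE : k`!%:R ^+ 2 * ek k A =
    \sum_f \sum_g w f * w g * \prod_l A (f l) (g l).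
  rewrite (ek_sum_injective _ i0).
  under eq_bigr => f _.
    rewrite (sum_injective (u := fun l i => A (f l) i)) //.
    over.
  rewrite -mulr_sumr exchange_big /=.
  under eq_bigr => g _.
    rewrite -mulr_sumr (sum_injective (u := fun l i => A i (g l))) //.
    rewrite mulrCA; over.
  rewrite -mulr_sumr mulrA -exprD addnn -muln2 mulnC exprM sqrrN !expr1n mul1r.
  rewrite exchange_big /=; under eq_bigr => g _ do rewrite mulr_sumr.
  apply: eq_bigr => f _; apply: eq_bigr => g _ /=.
  rewrite /w; ring.
have w_bound f g : `|w f * w g| <= 2 ^+ k.
  have := fibre_weight_sqr C f; have := fibre_weight_sqr C g.
  rewrite card_ord => wg wf; rewrite -(@ler_pXn2r _ 2) ?nnegrE ?exprn_ge0 //.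
  by rewrite normrM exprMn [leRHS]expr2 ler_pM ?exprn_ge0.
pose rownorm i := l2norm (fun j => `|A i j|).
have rownorm0 i : 0 <= rownorm i by apply: l2norm_ge0.
have frobE : l2norm rownorm = frobenius A.
  congr sqrtC; apply: eq_bigr => i _; exact: sqrtCK.
have fact0 : 0 <= k`!%:R ^+ 2 :> C by rewrite exprn_ge0.
rewrite -[X in X * _](ger0_norm fact0) -normrM.
rewrite sumE; apply: le_trans (ler_norm_sum _ _ _) _.
pose ns (f : {ffun 'I_k -> 'I_n}) := no_singleton [set: 'I_k] f.
apply: (@le_trans _ _ (2 ^+ k * \sum_(f | ns f) \sum_(g | ns g)
    \prod_l `|A (f l) (g l)|)).
  rewrite mulr_sumr [leRHS]big_mkcond; apply: ler_sum => f _ /=.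
  case: ifPn => nsf; last first.
    by rewrite /w (fibre_weight_eq0 _ nsf) big1 ?normr0 // => g _; rewrite !mul0r.
  apply: le_trans (ler_norm_sum _ _ _) _.
  rewrite mulr_sumr [leRHS]big_mkcond; apply: ler_sum => g _ /=.
  case: ifPn => nsg; last first.
    by rewrite /w (fibre_weight_eq0 _ nsg) mulr0 mul0r normr0.
  by rewrite normrM normr_prod ler_wpM2r // prodr_ge0.
pose c : C := (2 * sqrtC k%:R) ^+ k.
have c0 : 0 <= c by rewrite exprn_ge0 // mulr_ge0 // sqrtC_ge0.
apply: (@le_trans _ _ (2 ^+ k * (c * (c * frobenius A ^+ k)))); last first.
  rewrite le_eqVlt; apply/orP; left; apply/eqP.
  rewrite /c -!exprMn; congr (_ ^+ _).
  rewrite -[X in _ = 8 * X * _]sqrtCK; ring.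
rewrite ler_wpM2l ?exprn_ge0 //.
apply: (@le_trans _ _ (\sum_(f | ns f) c * \prod_l rownorm (f l))).
  by apply: ler_sum => f _; apply: sum_no_singletonT i0 _ _.
rewrite -mulr_sumr ler_wpM2l //.
apply: le_trans (sum_no_singletonT i0 (v := fun _ => rownorm) _) _ => //.
by rewrite prodr_const card_ord frobE.
Qed.

(** * Numerical estimates and conclusion *)

Lemma exp_factorial (R : realType) (k : nat) :
  k%:R ^+ k <= k`!%:R * expR 1 ^+ k :> R.
Proof.
elim: k => [|k IH]; first by rewrite !expr0 mulr1.
(* That is, [(1 + 1/k)^k <= e]. *)
have step : k.+1%:R ^+ k <= k%:R ^+ k * expR 1 :> R.
  case: k {IH} => [|k].
    by rewrite !expr0 mul1r; have := expR_ge1Dx (1 : R); lra.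
  have k0 : 0 < k.+1%:R :> R by rewrite ltr0n.
  have -> : k.+2%:R = k.+1%:R * (1 + k.+1%:R^-1) :> R.
    by rewrite mulrDr mulfV ?gt_eqF // mulr1 natr1.
  rewrite exprMn ler_wpM2l ?exprn_ge0 //.
  have -> : expR 1 = expR k.+1%:R^-1 ^+ k.+1 :> R.
    by rewrite -expRM_natl mulfV // gt_eqF.
  rewrite lerXn2r ?nnegrE ?expR_ge0 ?expR_ge1Dx //.
  by rewrite addr_ge0 // invr_ge0 ltW.
rewrite factS natrM exprS [expR 1 ^+ _]exprSr -mulrA ler_wpM2l //.
apply: le_trans step _; rewrite mulrA ler_wpM2r ?expR_ge0 //.
Qed.

(** Factor by factor, [n (k - j) <= k (n - j)]. *)
Lemma expn_le_bin n k : (k <= n)%N -> (n ^ k <= k ^ k * 'C(n, k))%N.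
Proof.
move=> kn; rewrite -(leq_pmul2r (fact_gt0 k)) -mulnA bin_ffact.
rewrite -(ffactnn k) !ffact_prod.
rewrite -[X in (n ^ X)%N]card_ord -[X in (k ^ X)%N]card_ord.
rewrite -!prod_nat_const -!big_split /=; apply: leq_prod => j _.
by rewrite !mulnBr mulnC leq_sub2l // leq_mul2r kn orbT.
Qed.

Theorem theorem1p2 (R : realType) :
  (exists B : R, 0 < B /\ ek_bound B) /\ ek_bound (8 * expR 1 ^+ 2 : R).
Proof.
suff bound : ek_bound (8 * expR 1 ^+ 2 : R).
  split=> //; exists (8 * expR 1 ^+ 2); split=> //.
  by rewrite mulr_gt0 // exprn_gt0 // expR_gt0.
move=> n A k n0 A1 AT1 frobA /andP[k0 kn].
have := ek_frobenius_bound k n0 A1 AT1; rewrite frobA => ek_le.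
have real_bound : (8 * k%:R * n%:R) ^+ k <=
    k`!%:R ^+ 2 * ((8 * expR 1 ^+ 2) ^+ k * 'C(n, k)%:R) :> R.
  have nk_le : n%:R ^+ k <= k%:R ^+ k * 'C(n, k)%:R :> R.
    by rewrite -!natrX -natrM ler_nat expn_le_bin.
  apply: (@le_trans _ _ (8 ^+ k * k%:R ^+ k * (k%:R ^+ k * 'C(n, k)%:R))).
    by rewrite !exprMn ler_wpM2l // mulr_ge0 ?exprn_ge0.
  rewrite [leLHS](_ : _ = (8 ^+ k * 'C(n, k)%:R) * (k%:R ^+ k) ^+ 2); last by ring.
  rewrite [leRHS](_ : _ = (8 ^+ k * 'C(n, k)%:R) *
                          (k`!%:R * expR 1 ^+ k) ^+ 2); last first.
    by rewrite exprMn [in LHS]exprAC; ring.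
  rewrite ler_wpM2l ?mulr_ge0 ?exprn_ge0 // lerXn2r ?nnegrE ?exprn_ge0 //.
    by rewrite mulr_ge0 // exprn_ge0 // expR_ge0.
  exact: exp_factorial.
have kpos : 0 < k`!%:R ^+ 2 :> R[i] by rewrite exprn_gt0 // ltr0n fact_gt0.
rewrite -(ler_pM2l kpos); apply: le_trans ek_le _.
have := real_bound; rewrite -lecR.
by rewrite !(rmorphM, rmorphXn, rmorph_nat) /=.
Qed.
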